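(* Let $n\in\mathbb{N}$ and let $P\in[0,1]^{n\times n}$ be the transition matrix of an irreducible Markov chain on $[n]=\{1,\dots,n\}$, with stationary distribution $\pi$ (a column vector). Let $L_{\mathrm{kill}} = I_{n^2}-(P\otimes P)E$, and let its singular values (with multiplicities), ordered non-increasingly, be $$\widetilde\sigma_1\ge\widetilde\sigma_2\ge\dots\ge\widetilde\sigma_{n^2}>0 ,$$ where the last strict inequality is part of the setting. Let $\widetilde u_i,\widetilde v_i\in\mathbb{R}^{n^2}$, $i\in[n^2]$, be corresponding left and right singular vectors. Then $$\operatorname{vec}\Big(\big(\mathbf{E}[\tau_{\mathrm{meet}}(i,j)]\big)_{i,j\in[n]}\Big) = E\,\big(I_{n^2}-(P\otimes P)E\big)^{-1}\mathbf{1}_{n^2},$$ and in particular $$t^{\pi}_{\mathrm{meet}} = (\pi\otimes\pi)^t E\,\big(I_{n^2}-(P\otimes P)E\big)^{-1}\mathbf{1}_{n^2} = -1+\sum_{i=1}^{n^2}\frac{1}{\widetilde\sigma_i}(\pi\otimes\pi)^t\,\widetilde v_i\,\widetilde u_i^{\,t}\,\mathbf{1}_{n^2}.$$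
   Context: Vectors in $\mathbb{R}^{n^2}$ and $n^2\times n^2$ matrices are indexed by pairs $(k,\ell)\in[n]^2$ via the identification $(k,\ell)\mapsto (k-1)n+\ell\in[n^2]$. The Kronecker product satisfies $(P\otimes P)_{(i,j),(k,\ell)}=P_{ik}P_{j\ell}$, and $(\pi\otimes\pi)_{(i,j)}=\pi_i\pi_j$. For $C\in\mathbb{R}^{n\times n}$, $\operatorname{vec}(C)\in\mathbb{R}^{n^2}$ is defined by $\operatorname{vec}(C)_{(i,j)}=C_{ij}$. $I_{n^2}$ is the identity matrix, and $\mathbf{1}_{n^2}$ is the vector with all $n^2$ coordinates equal to $1$. The matrix $E\in\{0,1\}^{n^2\times n^2}$ is the diagonal matrix $E_{(i,j),(k,\ell)}=\mathbb{1}\{(i,j)=(k,\ell)\}\,\mathbb{1}\{k\ne\ell\}$. Singular vectors are taken from a singular value decomposition $L_{\mathrm{kill}}=\widetilde U\widetilde\Sigma\widetilde V^t$ with $\widetilde U,\widetilde V$ orthogonal with columns $\widetilde u_i$ and $\widetilde v_i$, and $\widetilde\Sigma=\operatorname{diag}(\widetilde\sigma_1,\dots,\widetilde\sigma_{n^2})$. Meeting time: let $(X_t)_{t\ge0}$, $(Y_t)_{t\ge0}$ be independent discrete-time Markov chains on $[n]$, both with transition matrix $P$, with $X_0=i$, $Y_0=j$. Then $\tau_{\mathrm{meet}}(i,j)=\inf\{t\in\mathbb{Z}_{\ge0}:X_t=Y_t\}$ ($=\infty$ if they never meet), and $t^{\pi}_{\mathrm{meet}}=\sum_{i,j\in[n]}\pi_i\pi_j\,\mathbf{E}[\tau_{\mathrm{meet}}(i,j)]$.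 *)

(* Defs.v *)
From HB Require Import structures.
From mathcomp Require Export all_boot all_order all_algebra.
From mathcomp Require Export all_classical all_reals all_analysis.
From mathcomp Require Export mxtens.

Set Implicit Arguments.
Unset Strict Implicit.
Unset Printing Implicit Defensive.

Import Order.TTheory GRing.Theory Num.Theory.

Local Open Scope classical_set_scope.
Local Open Scope ring_scope.

Definition transition_matrix (R : realType) (n : nat) (P : 'M[R]_n) : Prop :=
  (forall i j, 0 <= P i j <= 1) /\ (forall i, \sum_j P i j = 1).

Definition irreducible (R : realType) (n : nat) (P : 'M[R]_n) : Prop :=
  forall i j, exists t : nat, 0 < (P ^+ t) i j.

(* The normalisation forces n > 0. *)
Definition stationary (R : realType) (n : nat) (P : 'M[R]_n) (pi : 'cV[R]_n)
    : Prop :=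
  [/\ forall i, 0 <= pi i 0, \sum_i pi i 0 = 1 & pi^T *m P = pi^T].

(* Coordinates in 'I_(n * n) are identified with pairs by the row-major
   bijection [mxtens_index (i, j) = i * n + j] (0-based) of mxtens, which is
   also the one underlying the Kronecker product [*t]. *)
Definition vec (T : Type) (n : nat) (C : 'M[T]_n) : 'cV[T]_(n * n) :=
  \col_k C (mxtens_unindex k).1 (mxtens_unindex k).2.

Definition kron_vec (R : realType) (n : nat) (pi : 'cV[R]_n) : 'cV[R]_(n * n) :=
  pi *t pi.

Definition offdiag (R : realType) (n : nat) : 'M[R]_(n * n) :=
  \matrix_(r, c)
    ((r == c) && ((mxtens_unindex c).1 != (mxtens_unindex c).2))%:R.

Definition Lkill (R : realType) (n : nat) (P : 'M[R]_n) : 'M[R]_(n * n) :=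
  1%:M - (P *t P) *m offdiag R n.

Definition orthogonal_mx (R : realType) (m : nat) (U : 'M[R]_m) : Prop :=
  U *m U^T = 1%:M /\ U^T *m U = 1%:M.

Definition svd (R : realType) (m : nat) (A U : 'M[R]_m) (sigma : 'rV[R]_m)
    (V : 'M[R]_m) : Prop :=
  [/\ orthogonal_mx U, orthogonal_mx V,
      forall i, 0 <= sigma 0 i,
      forall i j : 'I_m, (i <= j)%N -> sigma 0 j <= sigma 0 i &
      A = U *m diag_mx sigma *m V^T].

Section Processes.
Context (R : realType) (n : nat) (d : measure_display) (Omega : measurableType d).
Implicit Types (Pr : probability Omega R) (X Y : nat -> Omega -> 'I_n).

(* [X 0 = i] holds almost surely.  The Markov property is written in product form, so that no conditioning on
   null events occurs. *)
Definition markov_chain Pr (P : 'M[R]_n) (i : 'I_n) X : Prop :=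
  [/\ forall t x, measurable [set w | X t w = x],
      Pr [set w | X 0%N w = i] = 1%:E &
      forall (t : nat) (x : nat -> 'I_n),
        Pr [set w | forall s, (s <= t.+1)%N -> X s w = x s] =
        (Pr [set w | forall s, (s <= t)%N -> X s w = x s]
           * (P (x t) (x t.+1))%:E)%E].

Definition sigma_process X : set (set Omega) :=
  <<s [set A | exists t x, A = [set w | X t w = x]] >>.

Definition independent_processes Pr X Y : Prop :=
  forall A B, sigma_process X A -> sigma_process Y B ->
    Pr (A `&` B) = (Pr A * Pr B)%E.

(* The infimum of the empty set is +oo. *)
Definition tau_meet X Y (w : Omega) : \bar R :=
  ereal_inf [set t%:R%:E | t in [set t : nat | X t w = Y t w]].

Definition mean_meet Pr X Y : \bar R := (\int[Pr]_w tau_meet X Y w)%E.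

End Processes.

Definition t_meet (R : realType) (n : nat) (pi : 'cV[R]_n)
    (Etau : 'M[\bar R]_n) : \bar R :=
  (\sum_(i < n) \sum_(j < n) (pi i 0 * pi j 0)%:E * Etau i j)%E.

(* Main.v *)
Require Import Defs.
From mathcomp Require Import measurable_realfun.
Import numFieldNormedType.Exports.

Set Implicit Arguments.
Unset Strict Implicit.
Unset Printing Implicit Defensive.

Import Order.TTheory GRing.Theory Num.Theory.

Local Open Scope classical_set_scope.
Local Open Scope ring_scope.


(** The proof rests on two observations.

    Killing the pair chain.  For two independent copies X, Y of the chain, the
    pair Z = (X, Y) is itself a Markov chain, with transition matrix
    Q = P *t P ([markov_chain_tens]), and the meeting time is the first time
    that Z leaves the off-diagonal set D.  For any finite chain and any set D
    of states with indicator matrix E, the chain started at z stays in D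
    during times 0, ..., t with probability (E (Q E)^t 1)_z ([stay_prob]).
    Since a hitting time is the sum over t of the indicators of not having
    been hit by time t, its mean is the sum over t of these probabilities.

    Summing the geometric series.  The vectors (Q E)^t 1 are nonnegative and
    decrease in t because Q E is substochastic, so they converge; the limit l
    satisfies Q E l = l, hence (1 - Q E) l = 0, and l = 0 as 1 - Q E is
    invertible ([survival_cvg0]).  The telescoping identity
    (1 - Q E) \sum_(t < T) (Q E)^t 1 = 1 - (Q E)^T 1 then shows that the series
    sums to (1 - Q E)^-1 1 ([survival_sum]).  In particular the mean is finite.
    Together these give [mean_hitting_time], the first claimed formula.

    The singular value formula is linear algebra.  With L = 1 - Q E and
    mu = pi *t pi, stationarity mu^T Q = mu^T gives
    mu^T E L^-1 = mu^T Q E L^-1 = mu^T (1 - L) L^-1 = mu^T L^-1 - mu^T,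
    so pairing with the vector 1 leaves mu^T L^-1 1 - 1, and L^-1 is expanded
    along the singular vectors ([svd_invmx]). *)

(** * Survival vectors of a substochastic matrix *)

Definition kill (R : realType) (N : nat) (D : pred 'I_N) : 'M[R]_N :=
  diag_mx (\row_k (D k)%:R).

Lemma mul_kill_colE (R : realType) (N : nat) (D : pred 'I_N) (v : 'cV[R]_N) k :
  (kill R D *m v) k 0 = (D k)%:R * v k 0.
Proof. by rewrite mul_diag_mx !mxE. Qed.

(** The vector A^t 1: when A is substochastic, its k-th entry is the probability
    that the chain with kernel A, started at k, is alive after t steps. *)
Definition survival (R : realType) (N : nat) (A : 'M[R]_N) (t : nat) :
  'cV[R]_N := iter t (mulmx A) (const_mx 1).

Lemma survivalS (R : realType) (N : nat) (A : 'M[R]_N) t k :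
  survival A t.+1 k 0 = \sum_j A k j * survival A t j 0.
Proof. by rewrite [LHS]mxE. Qed.

Section Substochastic.
Variables (R : realType) (N : nat) (A : 'M[R]_N).
Hypotheses (A_ge0 : forall i j, 0 <= A i j)
  (A_le1 : forall i, \sum_j A i j <= 1).

Lemma survival_ge0 t k : 0 <= survival A t k 0.
Proof.
elim: t k => [|t IH] k; first by rewrite mxE.
by rewrite survivalS sumr_ge0 // => j _; rewrite mulr_ge0.
Qed.

Lemma survival_decr k :
  {homo (fun t => survival A t k 0) : s t / (s <= t)%N >-> t <= s}.
Proof.
apply/nonincreasing_seqP => t; elim: t k => [|t IH] k.
  rewrite survivalS [leRHS]mxE; apply: le_trans (A_le1 k).
  by apply: ler_sum => j _; rewrite mxE mulr1.
rewrite !survivalS; apply: ler_sum => j _.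
by apply: ler_wpM2l; rewrite ?IH.
Qed.

Hypothesis L_unit : 1%:M - A \in unitmx.

(** The entries decrease and are bounded below, so they converge; the limit
    vector is fixed by A, and invertibility of 1 - A leaves only 0. *)
Lemma survival_cvg0 k : survival A t k 0 @[t --> \oo] --> (0 : R).
Proof.
have cvgs j : cvgn (fun t => survival A t j 0).
  apply: nonincreasing_is_cvgn; first exact: survival_decr.
  by exists 0 => _ [t _ <-]; exact: survival_ge0.
pose l : 'cV[R]_N := \col_j limn (fun t => survival A t j 0).
have fix_l : A *m l = l.
  apply/matrixP => i j; rewrite ord1 {j} [RHS]mxE.
  apply/esym/cvg_lim => //.
  rewrite -(cvg_shiftS (fun t => survival A t i 0)).
  under eq_fun do rewrite /= survivalS.
  rewrite mxE; apply: cvg_big => //.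
    exact: add_continuous.
  by move=> j _; apply: (cvgM (cvg_cst _)); rewrite mxE; apply: cvgs.
have l0 : l = 0.
  by rewrite -[l](mulKmx L_unit) mulmxBl mul1mx fix_l subrr mulmx0.
have <- : limn (fun t => survival A t k 0) = 0.
  by have := congr1 (fun v : 'cV_N => v k 0) l0; rewrite !mxE.
exact: cvgs.
Qed.

(** A Neumann series applied to the vector 1 only: by telescoping, the T-th
    partial sum is (1 - A)^-1 (1 - A^T 1), and A^T 1 tends to 0. *)
Lemma survival_sum k :
  \sum_(0 <= t < T) survival A t k 0 @[T --> \oo] -->
    (invmx (1%:M - A) *m (const_mx 1 : 'cV_N)) k 0.
Proof.
have partial T : \sum_(0 <= t < T) survival A t k 0 =
    (invmx (1%:M - A) *m (const_mx 1 - survival A T)) k 0.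
  transitivity ((\sum_(0 <= t < T) survival A t) k 0).
    by rewrite summxE.
  rewrite -[\sum_(_ <= _ < _) _](mulKmx L_unit); congr ((_ *m _) k 0).
  elim: T => [|T IH]; first by rewrite big_nil mulmx0 subrr.
  rewrite big_nat_recr //= mulmxDr IH mulmxBl mul1mx.
  by rewrite addrA subrK.
under eq_fun do rewrite partial mxE.
rewrite mxE; apply: cvg_big => //; first exact: add_continuous.
move=> j _; apply: (cvgM (cvg_cst _)).
have cvg1 : 1 - survival A t j 0 @[t --> \oo] --> (1 - 0 : R).
  by apply: cvgB; [exact: cvg_cst | exact: survival_cvg0].
rewrite subr0 in cvg1.
under eq_fun do rewrite !mxE.
by rewrite mxE.
Qed.

End Substochastic.

(** * Inverse of a matrix from its singular value decomposition *)

Section SVD.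
Variables (R : realType) (m : nat) (A U V : 'M[R]_m) (sigma : 'rV[R]_m).
Hypotheses (hsvd : svd A U sigma V) (sigma_gt0 : forall i, 0 < sigma 0 i).

Lemma svd_mulmx_inv :
  A *m (V *m diag_mx (\row_i (sigma 0 i)^-1) *m U^T) = 1%:M.
Proof.
case: hsvd => -[UUt UtU] [VVt VtV] _ _ ->.
rewrite !mulmxA -(mulmxA _ V^T V) VtV mulmx1 -(mulmxA U) mulmx_diag.
rewrite (_ : \row_i _ = const_mx 1) ?diag_const_mx ?mulmx1 //.
by apply/rowP => i; rewrite !mxE mulfV // gt_eqF.
Qed.

Lemma svd_unitmx : A \in unitmx.
Proof. by case/mulmx1_unit: svd_mulmx_inv. Qed.

Lemma svd_invmx :
  invmx A = \sum_i (sigma 0 i)^-1 *: (col i V *m (col i U)^T).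
Proof.
rewrite -[invmx A]mulmx1 -svd_mulmx_inv mulKmx ?svd_unitmx //.
apply/matrixP => i j; rewrite mxE summxE; apply: eq_bigr => k _.
rewrite mul_mx_diag !mxE big_ord1 !mxE.
by rewrite mulrA (mulrC (V i k)).
Qed.

End SVD.
(** * Infima and measures as sums *)

(** A first time in S equals the number of times t such that S does not occur
    up to t; both sides are infinite when S is empty. *)
Lemma ereal_inf_tail_sum (R : realType) (S : set nat) :
  ereal_inf [set t%:R%:E | t in S] =
  (\sum_(0 <= t <oo) (`[< forall s, (s <= t)%N -> ~ S s >]%:R)%:E)%E
    :> \bar R.
Proof.
have [[t0 St0]|S0] := pselect (exists t, S t); last first.
  have -> : S = set0 by rewrite -subset0 => t St; apply: S0; exists t.
  rewrite image_set0 ereal_inf0; apply/esym/eqyP => a _.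
  have [n an] : exists n, a <= n%:R.
    by exists (Num.trunc a).+1; exact/ltW/truncnS_gt.
  apply: (@le_trans _ _ n%:R%:E); first by rewrite lee_fin.
  apply: (le_trans _ (@nneseries_lim_ge _ _ predT 0 n _)); last first.
    by move=> t _ _; rewrite lee_fin.
  rewrite sumEFin lee_fin (eq_bigr (fun=> 1)) ?sumr_const_nat ?subn0 // => t _.
  by rewrite asboolT // => s _ Ss; apply: S0; exists s.
pose T := ex_minn (ex_intro (fun t => `[< S t >]) t0 (asboolT St0)).
have [ST minT] : S T /\ forall t, S t -> (T <= t)%N.
  rewrite /T; case: ex_minnP => m /asboolP Sm minm; split=> // t St.
  by apply: minm; apply/asboolP.
have -> : ereal_inf [set t%:R%:E | t in S] = T%:R%:E :> \bar R.
  apply/eqP; rewrite eq_le; apply/andP; split.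
    by apply: ereal_inf_lbound; exists T.
  by apply: le_ereal_inf_tmp => _ [t St <-]; rewrite lee_fin ler_nat minT.
rewrite (@nneseries_split _ _ 0 T) ?add0n => [|t _]; last by rewrite lee_fin.
rewrite eseries0 => [|t Tt _]; last by rewrite asboolF // => /(_ T Tt).
rewrite adde0 sumEFin big_nat (eq_bigr (fun=> 1)) => [|t /= tT].
  by rewrite -big_nat sumr_const_nat subn0.
by rewrite asboolT // => s st /minT; rewrite leqNgt (leq_ltn_trans st).
Qed.

Lemma measure_sum_fibres (R : realType) (N : nat) (d : measure_display)
    (Omega : measurableType d) (mu : {measure set Omega -> \bar R})
    (Y : Omega -> 'I_N) (B : set Omega) :
  (forall z, measurable [set w | Y w = z]) -> measurable B ->
  mu B = (\sum_z mu (B `&` [set w | Y w = z]))%E.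
Proof.
move=> mY mB.
have {1}-> : B =
    \bigcup_(z in [set` index_enum 'I_N]) (B `&` [set w | Y w = z]).
  apply/seteqP; split=> [w Bw|w [z _ []] //].
  by exists (Y w) => //=; rewrite mem_index_enum.
rewrite measure_fin_bigcup //
  => [|z z' _ _ [w [[_ /= <-] [_ /= <-]]]//|z _].
  by rewrite -fsbig_seq// index_enum_uniq.
exact: measurableI.
Qed.

(** * The chain of an independent pair *)

Section Chain.
Variables (R : realType) (N : nat) (d : measure_display).
Variables (Omega : measurableType d) (Pr : probability Omega R).

Lemma prefix_measurable (Z : nat -> Omega -> 'I_N) (z : nat -> 'I_N) t :
  (forall t x, measurable [set w | Z t w = x]) ->
  measurable [set w | forall s, (s <= t)%N -> Z s w = z s].
Proof.
move=> mZ; have -> : [set w | forall s, (s <= t)%N -> Z s w = z s] =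
  \bigcap_(s in [set s | (s <= t)%N]) [set w | Z s w = z s] by [].
by apply: bigcap_measurable => //; exists 0%N.
Qed.

Lemma stay_measurable (Z : nat -> Omega -> 'I_N) (D : pred 'I_N) (I : set nat) :
  (forall t x, measurable [set w | Z t w = x]) ->
  measurable [set w | forall s, I s -> D (Z s w)].
Proof.
move=> mZ; have -> : [set w | forall s, I s -> D (Z s w)] =
  \bigcap_(s in I) [set w | D (Z s w)] by [].
have [[s Is]|I0] := pselect (exists s, I s); last first.
  rewrite (_ : I = set0) ?bigcap_set0 //.
  by rewrite -subset0 => s Is; apply: I0; exists s.
apply: bigcap_measurable => [|t _]; first by exists s.
rewrite (_ : [set w | _] = \bigcup_(z in [set z | D z]) [set w | Z t w = z]).
  by apply: fin_bigcup_measurable.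
by apply/seteqP; split=> [w Dw|w [z Dz /= ->] //]; exists (Z t w).
Qed.

Lemma sigma_process_prefix (X : nat -> Omega -> 'I_N) (x : nat -> 'I_N) t :
  sigma_process X [set w | forall s, (s <= t)%N -> X s w = x s].
Proof.
have -> : [set w | forall s, (s <= t)%N -> X s w = x s] =
  \bigcap_(s in [set s | (s <= t)%N]) [set w | X s w = x s] by [].
apply: (@bigcap_measurable _ (g_sigma_algebraType _)); first by exists 0%N.
by move=> s _; apply: sub_sigma_algebra; exists s, (x s).
Qed.

(** Independence factors the probability of a path of the pair into those of
    its two coordinate paths, and each factor gains one transition probability
    per step; the product of these two is an entry of P *t P'. *)
Lemma markov_chain_tens (P P' : 'M[R]_N) i j (X Y : nat -> Omega -> 'I_N) :
  markov_chain Pr P i X -> markov_chain Pr P' j Y ->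
  independent_processes Pr X Y ->
  markov_chain Pr (P *t P') (mxtens_index (i, j))
    (fun t w => mxtens_index (X t w, Y t w)).
Proof.
move=> [mX X0 Xstep] [mY Y0 Ystep] XY.
have pairE x y (k : 'I_(N * N)) : (mxtens_index (x, y) = k) <->
    x = (mxtens_unindex k).1 /\ y = (mxtens_unindex k).2.
  split=> [<-|]; first by rewrite mxtens_indexK.
  by case: (mxtens_unindex k) (mxtens_unindexK k) => a b /= <- [-> ->].
have prefixE t (z : nat -> 'I_(N * N)) :
    [set w | forall s, (s <= t)%N -> mxtens_index (X s w, Y s w) = z s] =
    [set w | forall s, (s <= t)%N -> X s w = (mxtens_unindex (z s)).1] `&`
    [set w | forall s, (s <= t)%N -> Y s w = (mxtens_unindex (z s)).2].
  apply/seteqP; split=> [w H|w [Hx Hy] s st].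
    by split=> s /H /pairE [].
  by apply/pairE; rewrite Hx ?Hy.
have prefix_prob t z : Pr [set w | forall s, (s <= t)%N ->
      mxtens_index (X s w, Y s w) = z s] =
    (Pr [set w | forall s, (s <= t)%N -> X s w = (mxtens_unindex (z s)).1] *
     Pr [set w | forall s, (s <= t)%N -> Y s w = (mxtens_unindex (z s)).2])%E.
  by rewrite prefixE XY //; exact: sigma_process_prefix.
split.
- move=> t k; rewrite (_ : [set w | _] =
    [set w | X t w = (mxtens_unindex k).1] `&`
    [set w | Y t w = (mxtens_unindex k).2]); first exact: measurableI.
  by apply/seteqP; split=> w; rewrite /setI/= pairE.
- rewrite (_ : [set w | _] = [set w | X 0%N w = i] `&` [set w | Y 0%N w = j]).
    rewrite XY ?X0 ?Y0 ?mule1 //; apply: sub_sigma_algebra.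
      by exists 0%N, i.
    by exists 0%N, j.
  by apply/seteqP; split=> w; rewrite /setI/= pairE mxtens_indexK.
- move=> t z; rewrite !prefix_prob Xstep Ystep.
  rewrite -[z t in RHS]mxtens_unindexK -[z t.+1 in RHS]mxtens_unindexK.
  case: (mxtens_unindex (z t)) => a b.
  case: (mxtens_unindex (z t.+1)) => a' b' /=.
  by rewrite tensmxE EFinM muleACA.
Qed.

End Chain.

(** * Mean hitting times of a finite Markov chain *)

Section HittingTime.
Variables (R : realType) (N : nat) (d : measure_display).
Variables (Omega : measurableType d) (Pr : probability Omega R).
Variables (Q : 'M[R]_N) (i : 'I_N) (Z : nat -> Omega -> 'I_N).
Hypothesis hZ : markov_chain Pr Q i Z.
Variable D : pred 'I_N.

Let mZ t x : measurable [set w | Z t w = x].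
Proof. by case: hZ. Qed.

(** Conditioning on a whole initial path, rather than on the current state,
    keeps every event in the product form of the Markov property, so that the
    induction on the number m of further steps splits only on the state at
    time k + 1. *)
Lemma prefix_stay_prob m k (z : nat -> 'I_N) :
  Pr ([set w | forall s, (s <= k)%N -> Z s w = z s] `&`
      [set w | forall s, (k < s <= k + m)%N -> D (Z s w)]) =
  (Pr [set w | forall s, (s <= k)%N -> Z s w = z s]
     * (survival (Q *m kill R D) m (z k) 0)%:E)%E.
Proof.
elim: m k z => [|m IH] k z.
  rewrite mxE mule1; congr (Pr _); apply/seteqP; split=> [w []//|w Hw].
  by split=> // s; rewrite addn0 ltnNge => /andP[/negbTE->].
rewrite (@measure_sum_fibres _ _ _ _ Pr (Z k.+1)) //; last first.
  apply: measurableI; first exact: prefix_measurable.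
  exact: (@stay_measurable _ _ _ _ _ [set s | (k < s <= k + m.+1)%N]).
have [_ _ step] := hZ.
have -> : survival (Q *m kill R D) m.+1 (z k) 0 =
    \sum_y Q (z k) y * ((D y)%:R * survival (Q *m kill R D) m y 0).
  rewrite /survival/= -mulmxA mxE; apply: eq_bigr => y _.
  by rewrite mul_kill_colE.
have finp : Pr [set w | forall s, (s <= k)%N -> Z s w = z s] \is a fin_num.
  exact/fin_num_measure/prefix_measurable.
rewrite -(fineK finp) -EFinM mulr_sumr -sumEFin; apply: eq_bigr => y _.
case Dy: (D y); last first.
  rewrite mul0r !mulr0 -[RHS](@measure0 _ _ _ Pr); congr (Pr _).
  rewrite -subset0 => w [[_ Hw] /= Zy].
  by have := Hw k.+1; rewrite Zy Dy leqnn addnS ltnS leq_addr => /(_ isT).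
(* The path z up to time k, prolonged by the state y at time k + 1. *)
pose z' s := if (s <= k)%N then z s else y.
have z'k s : (s <= k)%N -> z' s = z s by rewrite /z' => ->.
have z'k1 : z' k.+1 = y by rewrite /z' ltnn.
transitivity (Pr ([set w | forall s, (s <= k.+1)%N -> Z s w = z' s] `&`
      [set w | forall s, (k.+1 < s <= k.+1 + m)%N -> D (Z s w)])).
  congr (Pr _); apply/seteqP; split=> w.
    move=> [[Hz HD] /= Zy]; split=> s.
      by rewrite leq_eqVlt => /predU1P[->|sk]; rewrite ?z'k1 // z'k // Hz.
    by move=> /andP[/ltnW ks sm]; apply: HD; rewrite ks addnS -addSn.
  move=> [/= Hz HD]; split; last by rewrite /= Hz.
  split=> s; first by move=> sk; rewrite Hz ?z'k // leqW.
  rewrite leq_eqVlt => /andP[/predU1P[<- _|ks sm]].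
    by rewrite Hz ?z'k1 ?Dy.
  by apply: HD; rewrite ks addSn -addnS.
rewrite IH step z'k1 z'k // mul1r !EFinM fineK // muleA; congr (Pr _ * _ * _)%E.
by apply/seteqP; split=> w Hw s sk; rewrite Hw ?z'k.
Qed.

Lemma stay_prob t :
  Pr [set w | forall s, (s <= t)%N -> D (Z s w)] =
  ((kill R D *m survival (Q *m kill R D) t) i 0)%:E.
Proof.
have [_ Z0 _] := hZ.
have mst (I : set nat) : measurable [set w | forall s, I s -> D (Z s w)].
  exact: stay_measurable.
(* The start is only almost sure, so events are first cut down to Z 0 = i. *)
have as0 (B : set Omega) : measurable B ->
    Pr B = Pr (B `&` [set w | Z 0%N w = i]).
  move=> mB; rewrite (measureDI Pr mB (mZ 0%N i)).
  rewrite [X in (X + _)%E](_ : _ = 0%E) ?add0e //.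
  apply: (@subset_measure0 _ _ _ _ _ (~` [set w | Z 0%N w = i])).
  - exact: measurableD.
  - exact: measurableC.
  - exact: subIsetr.
  by apply: (etrans (probability_setC _ (mZ 0%N i))); rewrite Z0 subee.
rewrite mul_kill_colE; have [Di|nDi] := boolP (D i); last first.
  rewrite mul0r as0; last exact: (mst [set s | (s <= t)%N]).
  rewrite -[RHS](@measure0 _ _ _ Pr); congr (Pr _).
  rewrite -subset0 => w [] /= Dw wi.
  by have := Dw 0%N (leq0n _); rewrite wi (negbTE nDi).
rewrite mul1r; have := prefix_stay_prob t 0 (fun=> i).
rewrite (_ : [set w | forall s, (s <= 0)%N -> _] = [set w | Z 0%N w = i]);
    last first.
  apply/seteqP; split=> [w /(_ 0%N)/(_ isT)//|w Hw s].
  by rewrite leqn0 => /eqP->.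
rewrite Z0 mul1e => <-; rewrite as0; last exact: (mst [set s | (s <= t)%N]).
congr (Pr _); apply/seteqP; split=> w [] /= H1 H2; split=> // s.
  by move=> /andP[_ st]; apply: H1.
by case: s => [|s] st; [rewrite H1 | apply: H2].
Qed.

(** The mean of the first time outside D is the sum over t of the probability
    of staying in D up to t, which is a series of survival probabilities. *)
Lemma mean_hitting_time :
  (forall x y, 0 <= Q x y) -> (forall x, \sum_y Q x y = 1) ->
  1%:M - Q *m kill R D \in unitmx ->
  (\int[Pr]_w ereal_inf [set t%:R%:E | t in [set t | ~~ D (Z t w)]])%E =
  ((kill R D *m invmx (1%:M - Q *m kill R D) *m (const_mx 1 : 'cV_N)) i 0)%:E.
Proof.
move=> Q_ge0 Q_sum1 L_unit.
pose stay t := [set w | forall s, (s <= t)%N -> D (Z s w)].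
have mstay t : measurable (stay t).
  exact: (@stay_measurable _ _ _ _ _ [set s | (s <= t)%N]).
have QkE x y : (Q *m kill R D) x y = Q x y * (D y)%:R.
  by rewrite mul_mx_diag !mxE.
transitivity (\int[Pr]_w (\sum_(0 <= t <oo) (\1_(stay t) w)%:E))%E.
  apply: eq_integral => w _; rewrite ereal_inf_tail_sum.
  apply: eq_eseriesr => t _; rewrite indicE; congr (_%:R%:E).
  congr nat_of_bool; apply/idP/idP => [/asboolP H|/set_mem H].
    by apply/mem_set => s /H /negP; rewrite negbK.
  by apply/asboolP => s st; apply/negP; rewrite negbK H.
rewrite integral_nneseries //; last first.
  by move=> t; apply/measurable_EFinP; exact: measurable_indic.
transitivity (\sum_(0 <= t <oo)
    ((kill R D *m survival (Q *m kill R D) t) i 0)%:E)%E.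
  apply: eq_eseriesr => t _; rewrite integral_indic // setIT.
  exact: stay_prob.
apply: cvg_lim => //.
under eq_fun do rewrite sumEFin.
apply: cvg_EFin; first by near=> T.
rewrite -mulmxA mul_kill_colE.
under eq_fun do under eq_bigr do rewrite mul_kill_colE.
under eq_fun do rewrite -mulr_sumr.
apply: (cvgM (cvg_cst _)); apply: survival_sum => // [x y|x].
  by rewrite QkE mulr_ge0.
rewrite -(Q_sum1 x); apply: ler_sum => y _.
by rewrite QkE ler_piMr // lern1 leq_b1.
Unshelve. all: by end_near.
Qed.

End HittingTime.

(** * Meeting times *)

Lemma offdiagE (R : realType) n :
  offdiag R n = kill R (fun k => (mxtens_unindex k).1 != (mxtens_unindex k).2).
Proof.
apply/matrixP => r c; rewrite !mxE eq_sym.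
by case: eqVneq => [->|]; rewrite ?mulr1n.
Qed.

Lemma sum_mxtens_unindex (V : nmodType) n (f : 'I_n -> 'I_n -> V) :
  \sum_k f (mxtens_unindex k).1 (mxtens_unindex k).2 = \sum_i \sum_j f i j.
Proof.
rewrite pair_bigA (reindex (@mxtens_index n n)).
  by apply: eq_bigr => p _; rewrite mxtens_indexK.
exists (@mxtens_unindex n n) => k _; first exact: mxtens_indexK.
exact: mxtens_unindexK.
Qed.

Theorem proposition1p1 (R : realType) (n : nat) (P : 'M[R]_n) (pi : 'cV[R]_n)
    (hP : transition_matrix P) (hirr : irreducible P) (hpi : stationary P pi)
    (U V : 'M[R]_(n * n)) (sigma : 'rV[R]_(n * n))
    (hsvd : svd (Lkill P) U sigma V) (hsigma : forall i, 0 < sigma 0 i)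
    (d : 'I_n -> 'I_n -> measure_display)
    (Omega : forall i j, measurableType (d i j))
    (Pr : forall i j, probability (Omega i j) R)
    (X Y : forall i j, nat -> Omega i j -> 'I_n)
    (hX : forall i j, markov_chain (Pr i j) P i (X i j))
    (hY : forall i j, markov_chain (Pr i j) P j (Y i j))
    (hXY : forall i j, independent_processes (Pr i j) (X i j) (Y i j)) :
  let Etau : 'M[\bar R]_n :=
    \matrix_(i, j) mean_meet (Pr i j) (X i j) (Y i j) in
  let E : 'M[R]_(n * n) := offdiag R n in
  let one : 'cV[R]_(n * n) := const_mx 1 in
  [/\ vec Etau = map_mx EFin (E *m invmx (1%:M - (P *t P) *m E) *m one),
      t_meet pi Etau =
        (((kron_vec pi)^T *m E *m invmx (1%:M - (P *t P) *m E) *m one) 0 0)%:E &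
      ((kron_vec pi)^T *m E *m invmx (1%:M - (P *t P) *m E) *m one) 0 0 =
        - 1 + \sum_(i < n * n) (sigma 0 i)^-1 *
                ((kron_vec pi)^T *m col i V *m (col i U)^T *m one) 0 0].
Proof.
have L_unit := svd_unitmx hsvd hsigma.
set L := Lkill P in hsvd L_unit.
move=> Etau E one; rewrite -[1%:M - _]/L.
have P_ge0 a b : 0 <= P a b by have [/(_ a b)/andP[]] := hP.
have PP_ge0 x y : 0 <= (P *t P) x y by rewrite mxE mulr_ge0.
have PP_sum1 x : \sum_y (P *t P) x y = 1.
  have [_ P1] := hP; under eq_bigr do rewrite mxE.
  rewrite (sum_mxtens_unindex
    (fun a b => P (mxtens_unindex x).1 a * P (mxtens_unindex x).2 b)).
  by under eq_bigr do rewrite -mulr_sumr P1 mulr1.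
have vecE : vec Etau = map_mx EFin (E *m invmx L *m one).
  apply/matrixP => k j; rewrite ord1 {j} [LHS]mxE [RHS]mxE.
  case: (mxtens_indexP k) => {k} i j; rewrite mxtens_indexK /= mxE.
  have := mean_hitting_time (markov_chain_tens (hX i j) (hY i j) (hXY i j))
    PP_ge0 PP_sum1.
  rewrite /E /L /Lkill offdiagE => /(_ _) <-; last by rewrite -offdiagE.
  apply: eq_integral => w _; rewrite /tau_meet; congr (ereal_inf (image _ _)).
  have diagE a b : ~~ ((mxtens_unindex (mxtens_index (a, b))).1
      != (mxtens_unindex (mxtens_index (a, b))).2 :> 'I_n) = (a == b).
    by rewrite negbK mxtens_indexK.
  apply/seteqP; split=> t H; first by rewrite /mkset diagE; exact/eqP.
  by apply/eqP; rewrite -diagE; exact: H.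
have kronE k : kron_vec pi k 0 =
    pi (mxtens_unindex k).1 0 * pi (mxtens_unindex k).2 0.
  by rewrite mxE; congr (pi _ _ * pi _ _); exact: ord1.
split=> //.
- transitivity (\sum_k (kron_vec pi k 0)%:E * vec Etau k 0%R)%E.
    apply: etrans (esym (sum_mxtens_unindex
      (fun a b => ((pi a 0 * pi b 0)%:E * Etau a b)%E))) _.
    by apply: eq_bigr => k _; rewrite kronE [vec _ _ _]mxE.
  rewrite vecE -!mulmxA [in RHS]mxE -sumEFin; apply: eq_bigr => k _.
  by rewrite [map_mx _ _ _ _]mxE [(kron_vec pi)^T _ _]mxE EFinM.
- have piPP : (kron_vec pi)^T *m (P *t P) = (kron_vec pi)^T.
    have [_ _ piP] := hpi; rewrite /kron_vec.
    (* [kron_vec pi] has 1 column while [pi *t pi] has 1 * 1 of them. *)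
    suff tensP : (pi *t pi)^T *m (P *t P) = (pi *t pi)^T by exact: tensP.
    by rewrite trmx_tens tensmx_mul piP.
  have pi_one : ((kron_vec pi)^T *m one) 0 0 = 1.
    have [_ pi1 _] := hpi; rewrite mxE.
    under eq_bigr do rewrite [(_^T) _ _]mxE [one _ _]mxE mulr1 kronE.
    rewrite (sum_mxtens_unindex (fun a b => pi a 0 * pi b 0)).
    by under eq_bigr do rewrite -mulr_sumr pi1 mulr1.
  have PPE : (P *t P) *m E = 1%:M - L by rewrite /L /Lkill opprB addrC subrK.
  have -> : (kron_vec pi)^T *m E *m invmx L =
      (kron_vec pi)^T *m invmx L - (kron_vec pi)^T.
    rewrite -[in LHS]piPP -(mulmxA _ (P *t P)) PPE.
    by rewrite mulmxBr mulmx1 mulmxBl -(mulmxA _ L) mulmxV // mulmx1.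
  rewrite mulmxBl [LHS]mxE [X in _ + X]mxE pi_one addrC; congr (_ + _).
  rewrite (svd_invmx hsvd hsigma) mulmx_sumr mulmx_suml summxE.
  by apply: eq_bigr => k _; rewrite -scalemxAr -scalemxAl mxE !mulmxA.
Qed.
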